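(* Let $\{x_n\}\subset A$ be a sequence generated by the quadratic regularization of the method of codifferential descent (QR-MCD) for minimizing $f$ over the closed convex set $A\subset U$, with parameters $\{\nu_n\},\{\mu_n\}\subset[0,+\infty]$, and let $x^*$ be a cluster point of $\{x_n\}$. Suppose that the codifferential mapping $Df$ is continuous at $x^*$ and uniformly approximates $f$ in a neighbourhood of $x^*$. Let also $f$ be bounded below on $A$, $\liminf_{n\to\infty}\nu_n>0$ and $\liminf_{n\to\infty}\mu_n>0$. Suppose finally that one of the following two assumptions holds true: (1) $\mathcal{H}$ is finite dimensional; (2) there exists $\widehat{\mu}>0$ such that $\{(b,w)\in\overline{d}f(x_n)\mid b\le\widehat{\mu}\}\subseteq\overline{d}_{\mu_n}f(x_n)$ for all sufficiently large $n\in\mathbb{N}$. Then $x^*$ is an inf-stationary point of $f$ on the set $A$. If, in addition, $f$ is convex, then $x^*$ is a point of global minimum of $f$ on $A$.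
   Context: Codifferentials. $\mathcal{H}$ is a real Hilbert space with inner product $\langle\cdot,\cdot\rangle$, $B(y,r)=\{z\in\mathcal{H}\mid\|z-y\|\le r\}$. A function $f$ defined in a neighbourhood of $x$ is codifferentiable at $x$ if there exist (nonempty) weakly compact convex sets $\underline{d}f(x),\overline{d}f(x)\subset\mathbb{R}\times\mathcal{H}$ such that for any $\Delta x\in\mathcal{H}$ $$\lim_{\alpha\to+0}\frac1\alpha\Big|f(x+\alpha\Delta x)-f(x)-\max_{(a,v)\in\underline{d}f(x)}(a+\alpha\langle v,\Delta x\rangle)-\min_{(b,w)\in\overline{d}f(x)}(b+\alpha\langle w,\Delta x\rangle)\Big|=0$$ and $\max_{(a,v)\in\underline{d}f(x)}a+\min_{(b,w)\in\overline{d}f(x)}b=0$. The pair $Df(x)=[\underline{d}f(x),\overline{d}f(x)]$ is called a codifferential of $f$ at $x$. Throughout, codifferentials are normalized: $\max_{(a,v)\in\underline{d}f(x)}a=\min_{(b,w)\in\overline{d}f(x)}b=0$. Setting. $U\subseteq\mathcal{H}$ is open, $f\colon U\to\mathbb{R}$ is codifferentiable on $U$, a codifferential mapping $x\mapsto Df(x)$, $x\in U$, is fixed, and $A\subset U$ is a closed convex set. $Df$ is continuous at a point if both multifunctions $\underline{d}f(\cdot)$, $\overline{d}f(\cdot)$ are Hausdorff continuous at this point. For $B(x,r)\subset U$, $\Delta x\in B(0,r)$, $\alpha\in(0,1]$ put $$\varepsilon_f(\alpha,\Delta x,x,r)=\frac1\alpha\Big(f(x+\alpha\Delta x)-f(x)-\max_{(a,v)\in\underline{d}f(x)}(a+\alpha\langle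 v,\Delta x\rangle)-\min_{(b,w)\in\overline{d}f(x)}(b+\alpha\langle w,\Delta x\rangle)\Big).$$ $Df$ uniformly approximates $f$ on a set $C\subset U$ if there exists $r>0$ such that $B(x,r)\subseteq U$ for all $x\in C$ and $\varepsilon_f(\alpha,\Delta x,x,r)\to0$ as $\alpha\to+0$ uniformly for all $\Delta x\in B(0,r)$ and $x\in C$. Truncated codifferential ($\operatorname{ext}$ = set of extreme points). For all $\nu,\mu\in[0,+\infty]$, set-valued mappings $\underline{d}_\nu f,\overline{d}_\mu f\colon U\rightrightarrows\mathbb{R}\times\mathcal{H}$ are given such that for all $x\in U$: $\{(a,v)\in\operatorname{ext}\underline{d}f(x)\mid a\ge-\nu\}\subseteq\underline{d}_\nu f(x)\subseteq\underline{d}f(x)$ and $\{(b,w)\in\operatorname{ext}\overline{d}f(x)\mid b\le\mu\}\subseteq\overline{d}_\mu f(x)\subseteq\overline{d}f(x)$. For $x\in U$, $z\in\overline{d}f(x)$, $h\in\mathcal{H}$ let $\varphi(h,z,x,\nu)=\max_{(a,v)\in\operatorname{cl}\operatorname{co}\underline{d}_\nu f(x)+z}(a+\langle v,h\rangle)+\frac12\|h\|^2$, and for given $\{x_n\},\{\nu_n\}$ let $\varphi_n(h,z)=\varphi(h,z,x_n,\nu_n)$. A point $x^*\in A$ is an inf-stationary point of $f$ on $A$ if, for some $\nu\ge0$, $\{0\}=\arg\min_{h\in A-x^*}\varphi(h,z,x^*,\nu)$ for all $z=(0,w)\in\operatorname{ext}\overline{d}f(x^* )$ (this does not depend on $\nu\ge0$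 or on the choice of the codifferential). QR-MCD. Choose sequences $\{\nu_n\},\{\mu_n\}\subset[0,+\infty]$, $\alpha_*\in(0,+\infty]$ and $x_0\in A$ (if $\alpha_*=+\infty$, then $[0,\alpha_*]$ means $[0,+\infty)$). At iteration $n\ge0$: for every $z\in\overline{d}_{\mu_n}f(x_n)$ let $h_n(z)$ be the unique minimizer of $\varphi_n(\cdot,z)$ over $A-x_n$; choose $\alpha_n(z)\in\arg\min\{f(x_n+\alpha h_n(z))\mid\alpha\in[0,\alpha_*],\ x_n+\alpha h_n(z)\in A\}$; choose $z_n\in\arg\min\{f(x_n+\alpha_n(z)h_n(z))\mid z\in\overline{d}_{\mu_n}f(x_n)\}$; and set $x_{n+1}=x_n+\alpha_n(z_n)h_n(z_n)$. It is assumed that $\alpha_n(z)$ and $z_n$ are well defined (the minima are attained) at every iteration. ''$f$ is convex'' means that $U$ is convex and $f$ is convex on $U$. *)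

(* Defs.v *)
From HB Require Import structures.
From mathcomp Require Import all_boot all_order all_algebra sesquilinear.
From mathcomp Require Import all_classical all_reals all_analysis.

Set Implicit Arguments.
Unset Strict Implicit.
Unset Printing Implicit Defensive.

Import Order.TTheory GRing.Theory Num.Theory.
Import numFieldNormedType.Exports.

Local Open Scope classical_set_scope.
Local Open Scope ring_scope.

(* A real Hilbert space is a [completeNormedModType R] together with a positive
   definite symmetric form [dot : {dot H for idfun}] that induces the norm.
   The product [R * H] carries the max norm of the library, which is equivalent
   to the Hilbert norm of the product, so that closures, continuous linear
   functionals and Hausdorff continuity are unaffected.

   Functions and multifunctions on an open set [U] are total functions on [H]
   whose values outside [U] are never used. *)

Definition argmin (R : realType) (T : Type) (S : set T) (g : T -> R) : set T :=
  [set t | S t /\ forall s, S s -> g t <= g s].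

Definition extreme_points (R : realType) (V : lmodType R) (S : set V) : set V :=
  [set z | S z /\ forall x y (t : R), S x -> S y -> 0 < t < 1 ->
                    z = t *: x + (1 - t) *: y -> x = z /\ y = z].

Definition convex_hull (R : realType) (V : lmodType R) (S : set V) : set V :=
  smallest (@convex_set R V) S.

Definition finite_dimensional (R : realType) (V : lmodType R) : Prop :=
  exists n, inhabited (Vector.axiom n V).

Definition dual_space (R : realType) (V : normedModType R) : Type :=
  {l : {linear V -> R^o} | continuous l}.

HB.instance Definition _ (R : realType) (V : normedModType R) :=
  gen_eqMixin (dual_space V).
HB.instance Definition _ (R : realType) (V : normedModType R) :=
  gen_choiceMixin (dual_space V).

Definition dual_eval (R : realType) (V : normedModType R) (v : V) :
    {ptws dual_space V -> R} :=
  fun l => projT1 l v.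

(* The weak topology is the initial topology for the family of all continuous
   linear functionals, that is, for the evaluation map into the product of
   copies of [R] indexed by the dual space. *)
Definition weakly_compact (R : realType) (V : normedModType R) (S : set V) :=
  compact (S : set (initial_topology (@dual_eval R V))).

Definition hausdorff_dist (R : realType) (V : normedModType R) (S T : set V) :
    \bar R :=
  let excess (S1 S2 : set V) :=
    ereal_sup [set ereal_inf [set `|s - t|%:E | t in S2] | s in S1] in
  Order.max (excess S T) (excess T S).

Definition hausdorff_continuous_at (R : realType) (H V : normedModType R)
    (F : H -> set V) (x : H) : Prop :=
  hausdorff_dist (F y) (F x) @[y --> x] --> (0 : \bar R)%E.

Section Codifferential.
Context (R : realType) (H : completeNormedModType R) (dot : {dot H for idfun}).
Implicit Types (f : H -> R) (S T : set (R * H)%type) (U A C : set H).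
Implicit Types (ld ud : H -> set (R * H)%type).
Implicit Types (ldt udt : \bar R -> H -> set (R * H)%type).
Implicit Types (x h dx : H) (z : (R * H)%type) (alpha : R) (nu mu : \bar R).

(* Maxima and minima of continuous affine functions over codifferentials are
   written [sup] and [inf]: the sets are nonempty and weakly compact (or closed
   convex subsets of such sets), hence the values are attained. *)
Definition codiff_error f S T alpha dx x : R :=
  alpha^-1 * (f (x + alpha *: dx) - f x
              - sup [set u.1 + alpha * dot u.2 dx | u in S]
              - inf [set u.1 + alpha * dot u.2 dx | u in T]).

Definition is_codifferential f x S T : Prop :=
  [/\ S !=set0 /\ T !=set0,
      convex_set S /\ convex_set T,
      weakly_compact S /\ weakly_compact T,
      forall dx, `|codiff_error f S T alpha dx x| @[alpha --> 0^'+] --> (0 : R)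
    & sup [set u.1 | u in S] + inf [set u.1 | u in T] = 0].

Definition normalized S T : Prop :=
  sup [set u.1 | u in S] = 0 /\ inf [set u.1 | u in T] = 0.

Definition uniformly_approximates U f ld ud C : Prop :=
  exists2 r : R, 0 < r &
    (forall x, C x -> closed_ball x r `<=` U) /\
    (forall e : R, 0 < e -> \forall alpha \near 0^'+,
       forall dx x, closed_ball (0 : H) r dx -> C x ->
         `|codiff_error f (ld x) (ud x) alpha dx x| < e).

Definition truncated_codifferential U ld ud ldt udt : Prop :=
  (forall nu x, (0 <= nu)%E -> U x ->
     [set u | extreme_points (ld x) u /\ (- nu <= u.1%:E)%E] `<=` ldt nu x
     /\ ldt nu x `<=` ld x) /\
  (forall mu x, (0 <= mu)%E -> U x ->
     [set u | extreme_points (ud x) u /\ (u.1%:E <= mu)%E] `<=` udt mu x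
     /\ udt mu x `<=` ud x).

Definition phi ldt h z x nu : R :=
  sup [set u.1 + dot u.2 h
      | u in [set y + z | y in closure (convex_hull (ldt nu x))]]
  + 2^-1 * `|h| ^+ 2.

Definition translate A x : set H := [set y - x | y in A].

Definition inf_stationary A ud ldt x : Prop :=
  A x /\ exists2 nu : R, 0 <= nu &
    forall w : H, extreme_points (ud x) (0, w) ->
      argmin (translate A x) (fun h => phi ldt h (0, w) x nu%:E) = [set 0].

(* [hn n z], [al n z] and [zn n] are the direction $h_n(z)$, the step size
   $\alpha_n(z)$ and the selected point $z_n$; as [a] below is real, the
   constraint [a%:E <= astar] is void when [astar = +oo]. *)
Definition qr_mcd f A ldt udt (nu mu : nat -> \bar R) (astar : \bar R)
    (xs : nat -> H) : Prop :=
  A (xs 0%N) /\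
  exists (hn : nat -> R * H -> H) (al : nat -> R * H -> R) (zn : nat -> R * H),
    forall n,
    [/\ forall z, udt (mu n) (xs n) z ->
          argmin (translate A (xs n)) (fun h => phi ldt h z (xs n) (nu n))
          = [set hn n z],
        forall z, udt (mu n) (xs n) z ->
          argmin [set a : R | [/\ 0 <= a, (a%:E <= astar)%E
                                & A (xs n + a *: hn n z)]]
                 (fun a => f (xs n + a *: hn n z)) (al n z),
        argmin (udt (mu n) (xs n))
               (fun z => f (xs n + al n z *: hn n z)) (zn n)
      & xs n.+1 = xs n + al n (zn n) *: hn n (zn n)].

End Codifferential.

(* Main.v *)
From HB Require Import structures.
Require Import Defs.
From mathcomp Require Import all_boot all_order all_algebra sesquilinear.
From mathcomp Require Import all_classical all_reals all_analysis.
From mathcomp Require Import ring lra.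
Set Implicit Arguments.
Unset Strict Implicit.

Import Order.TTheory GRing.Theory Num.Theory.
Import numFieldNormedType.Exports.
Local Open Scope classical_set_scope.
Local Open Scope ring_scope.

(** The argument is by contradiction. The crux is the half-space condition: for
    every [h] in [A - x*] and every [(0, w)] in the hyperdifferential at [x*]
    there is [(0, v)] in the hypodifferential with [<v + w, h> >= 0]. It implies
    inf-stationarity ([stationary_of_halfspace_condition]), and for convex [f]
    it bounds the directional derivative from below, hence gives global
    minimality ([convex_stationary_min]).

    Suppose that the condition fails for some [h] and [w]. A short multiple [h1]
    of [h] then gives the regularized model at [x*] a value at most [- m < 0]
    ([model_decrease]), and by Hausdorff continuity this survives at every [x]
    near [x*], with one proviso: the algorithm must examine a point [z] of
    the truncated hyperdifferential at [x] which behaves like [(0, w)]. Such a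
    [z] need not be close to [(0, w)]. It suffices that its first coordinate be
    small and that [<z.2, h1>] be at most slightly larger than [<w, h1>], and an
    extreme point which minimizes [b + t <w', h1>] over the hyperdifferential
    for a small [t > 0] has both properties ([extreme_near_slice]); being an
    extreme point with small first coordinate, it survives truncation.

    For this [z] the exact minimizer [hn] of the model has norm at most [4 M],
    where [M] bounds the codifferentials near [x*], and a step of fixed length
    [alpha] along [hn] decreases the linearization of [f] at rate [m]
    ([linearized_decrease]). Truncating the hypodifferential does no harm here:
    the linearization is maximized at an extreme point whose first coordinate
    is [O(alpha)]. Uniform approximation transfers the decrease to [f]
    ([descent_step]), so every late iterate close to [x*] lowers [f] by a fixed
    [beta > 0]. Infinitely many iterates are close to [x*] and [f] never
    increases along the sequence, which contradicts boundedness below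
    ([frequent_decrease_unbounded]).

    Two facts on weakly compact sets are used throughout: a continuous linear
    functional attains its minimum at an extreme point
    ([weakly_compact_extreme_argmin]), and weakly compact sets are bounded
    ([weakly_compact_bounded], by Banach-Steinhaus). *)

(** * Weakly compact sets and their extreme points *)

Section WeakTopology.
Context {R : realType} {V : normedModType R}.
Implicit Types (K F : set V) (l : dual_space V).
Local Notation weak := (initial_topology (@dual_eval R V)).

Lemma dual_eval_continuous l :
  continuous ((fun v => dual_eval v l) : weak -> R).
Proof.
move=> v.
apply: (@continuous_comp weak {ptws dual_space V -> R} R (@dual_eval R V)
  (fun g => g l)); first exact: initial_continuous.
exact: (@proj_continuous _ (fun=> R) l).
Qed.

Lemma dual_evalP l t x y :
  dual_eval (t *: x + (1 - t) *: y) l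
  = t * dual_eval x l + (1 - t) * dual_eval y l.
Proof. by rewrite /dual_eval linearD !linearZ. Qed.

Lemma weakly_compact_argmin K l : weakly_compact K -> K !=set0 ->
  argmin K (fun v => dual_eval v l) !=set0 /\
  weakly_compact (argmin K (fun v => dual_eval v l)).
Proof.
move=> cK K0.
have cl : continuous (fun v : weak => - dual_eval v l).
  by move=> v; apply: continuousN; exact: dual_eval_continuous.
have [c cK' cmin] := @compact_EVT_max weak R _ K K0 cK (continuous_subspaceT cl).
have cK1 : K c by move: cK'; rewrite inE.
have cmin1 u : K u -> dual_eval c l <= dual_eval u l.
  by move=> Ku; rewrite -lerN2; apply: cmin; rewrite inE.
split; first by exists c.
have -> : argmin K (fun v => dual_eval v l) =
    K `&` (fun v => dual_eval v l) @^-1` [set r | r <= dual_eval c l].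
  rewrite eqEsubset; split=> u /= [Ku um]; split=> //=; first exact: um.
  by move=> s Ks; apply: (le_trans um); exact: cmin1.
rewrite /weakly_compact; apply: (@compact_closedI weak) => //.
apply: (closed_comp (f := fun v : weak => dual_eval v l)).
  by move=> v _; exact: dual_eval_continuous.
exact: closed_le.
Qed.

(** The set of minimizers of a linear functional is a face: if a proper convex
    combination attains the minimum, then so do both of its ends. *)
Lemma extreme_points_argmin K l :
  extreme_points (argmin K (fun v => dual_eval v l)) `<=` extreme_points K.
Proof.
move=> e [[Ke emin] eext]; split=> // x y t Kx Ky t01 exy.
have le_x := emin _ Kx; have le_y := emin _ Ky.
have := congr1 (fun v => dual_eval v l) exy; rewrite dual_evalP => eqe.
have /andP[t0 t1] := t01.
have ex : dual_eval x l = dual_eval e l by nra.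
have ey : dual_eval y l = dual_eval e l by nra.
by apply: eext exy => //; split=> // s Ks; rewrite ?ex ?ey; exact: emin.
Qed.

(** The existence part of the Krein-Milman theorem. Zorn's lemma is applied to
    the complements [X] of closed nonempty extremal subsets [K \ X], ordered by
    inclusion; chains have upper bounds because [K] is compact. A minimal
    extremal subset is a singleton, since a functional that is not constant on
    it would cut out a smaller face. *)
Lemma weakly_compact_extreme_point K :
  (forall u v : V, u <> v -> exists l, dual_eval u l <> dual_eval v l) ->
  weakly_compact K -> K !=set0 -> extreme_points K !=set0.
Proof.
move=> sep cK K0.
pose P (X : set V) := [/\ open (X : set weak), (K `\` X) !=set0 &
  forall x y (t : R), K x -> K y -> 0 < t < 1 ->
    ~ X (t *: x + (1 - t) *: y) -> ~ X x /\ ~ X y].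
have chainP (F : set (set V)) : F `<=` P -> total_on F subset ->
    P (\bigcup_(X in F) X).
  move=> FP Ftot; split.
  - by apply: bigcup_open => X /FP[].
  - have [->|/set0P[X0 FX0]] := eqVneq F set0.
      by rewrite bigcup_set0 setD0.
    have GF : ProperFilter (filter_from F (fun X => K `\` X : set weak)).
      apply: filter_from_proper; last by move=> X /FP[].
      apply: filter_from_filter; first by exists X0.
      move=> X Y FX FY; have [XY|YX] := Ftot _ _ FX FY.
        by exists Y => // v [Kv Yv]; split; split=> // /XY.
      by exists X => // v [Kv Xv]; split; split=> // /YX.
    have [|p [Kp clp]] := cK _ GF; first by exists X0 => // v [].
    exists p; split=> // -[X FX Xp].
    have [oX _ _] := FP _ FX.
    have [||v [[_ nXv] Xv]] := clp (K `\` X) X; first by exists X.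
      exact: (@open_nbhs_nbhs weak p X (conj oX Xp)).
    exact: nXv.
  - move=> x y t Kx Ky t01 nX.
    have nX1 X : F X -> ~ X (t *: x + (1 - t) *: y) by move=> FX ?; apply: nX; exists X.
    by split=> -[X FX]; have [_ _ Xext] := FP _ FX;
      have [] := Xext _ _ _ Kx Ky t01 (nX1 _ FX).
have [A [[oA [e [Ke nAe]] Aext] Amax]] := Zorn_bigcup chainP.
have cF : weakly_compact (K `\` A).
  by rewrite /weakly_compact setDE; apply: (@compact_closedI weak) => //; exact: open_closedC.
(* By maximality of [A], every functional is constant on [K `\` A]. *)
have single u : K u -> ~ A u -> u = e.
  move=> Ku nAu; apply: contrapT => /sep[l lne].
  have [|[c [[Kc nAc] cmin]] _] := weakly_compact_argmin l cF; first by exists e.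
  pose B : set V := A `|` [set v | dual_eval c l < dual_eval v l].
  apply: (Amax B).
    rewrite properEneq; split; last by move=> v; left.
    apply/eqP => AB; apply: lne.
    have nB w : K w -> ~ A w -> dual_eval w l = dual_eval c l.
      move=> Kw nAw; apply/eqP; rewrite eq_le cmin// andbT leNgt; apply/negP => lt_cw.
      by apply: nAw; rewrite AB; right.
    by rewrite !nB.
  split.
  - apply: openU => //.
    have := @open_comp weak R (fun v => dual_eval v l) [set r | dual_eval c l < r].
    by apply; [move=> v _; exact: dual_eval_continuous | exact: open_gt].
  - by exists c; split=> // -[]// /=; rewrite ltxx.
  - move=> x y t Kx Ky t01 nBxy.
    have [nAx nAy] : ~ A x /\ ~ A y.
      by apply: Aext t01 _ => // Axy; apply: nBxy; left.
    have /= le_x := cmin x (conj Kx nAx); have /= le_y := cmin y (conj Ky nAy).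
    have : dual_eval (t *: x + (1 - t) *: y) l <= dual_eval c l.
      by rewrite leNgt; apply/negP => ?; apply: nBxy; right.
    rewrite dual_evalP => le_xy; have /andP[t0 t1] := t01.
    by split=> -[]//=; apply/negP; rewrite -leNgt; nra.
exists e; split=> // x y t Kx Ky t01 exy.
have [nAx nAy] := Aext _ _ _ Kx Ky t01 (eq_ind e (fun z => ~ A z) nAe _ exy).
by split; apply: single.
Qed.

(** Bauer's principle. The minimizers form a weakly compact face, and an extreme
    point of a face is an extreme point of the whole set. *)
Lemma weakly_compact_extreme_argmin K l :
  (forall u v : V, u <> v -> exists l, dual_eval u l <> dual_eval v l) ->
  weakly_compact K -> K !=set0 ->
  exists2 e, extreme_points K e & forall u, K u -> dual_eval e l <= dual_eval u l.
Proof.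
move=> sep cK K0; have [F0 cF] := weakly_compact_argmin l cK K0.
have [e eF] := weakly_compact_extreme_point sep cF F0.
by exists e; [exact: extreme_points_argmin eF | case: eF => -[]].
Qed.

(** A penalty estimate. The points of [K] where [g <= c] form a weakly compact
    set on which [p] is positive, so [p] is bounded away from zero there and
    dominates [t (c - g)] for small [t]. The bound is of first order in [t],
    which is what directional derivatives require. *)
Lemma perturbed_lower_bound K (p g : dual_space V) (c : R) :
  weakly_compact K -> (forall u, K u -> 0 <= dual_eval u p) ->
  (forall u, K u -> dual_eval u p = 0 -> c < dual_eval u g) ->
  exists2 t0, 0 < t0 & forall t u, 0 < t <= t0 -> K u ->
    t * c <= dual_eval u p + t * dual_eval u g.
Proof.
move=> cK p_ge0 g_gt.
pose K' := K `&` (fun v => dual_eval v g) @^-1` [set r | r <= c].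
have cK' : weakly_compact K'.
  rewrite /weakly_compact; apply: (@compact_closedI weak) => //.
  apply: (closed_comp (f := fun v : weak => dual_eval v g)).
    by move=> v _; exact: dual_eval_continuous.
  exact: closed_le.
have outside t u : 0 < t -> K u -> ~ K' u -> t * c <= dual_eval u p + t * dual_eval u g.
  move=> t0 Ku nK'u; have := p_ge0 _ Ku.
  have : c < dual_eval u g by rewrite ltNge; apply/negP => ?; exact: nK'u.
  nra.
have [K'0|/set0P K'0] := eqVneq K' set0.
  by exists 1 => // t u /andP[t0 _] Ku; apply: outside => //; rewrite K'0.
have [[u0 [[Ku0 /= gu0] pmin]] _] := weakly_compact_argmin p cK' K'0.
have [[u1 [[Ku1 /= gu1] gmin]] _] := weakly_compact_argmin g cK' K'0.
have d0 : 0 < dual_eval u0 p.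
  rewrite lt_neqAle p_ge0// andbT; apply/eqP => /esym /(g_gt _ Ku0).
  by rewrite ltNge gu0.
have D0 : 0 < c - dual_eval u1 g + 1 by lra.
exists (dual_eval u0 p / (c - dual_eval u1 g + 1)); first exact: divr_gt0.
move=> t u /andP[t0]; rewrite ler_pdivlMr// => t1 Ku.
have [K'u|] := pselect (K' u); last exact: outside.
have := pmin _ K'u; have := gmin _ K'u; nra.
Qed.
End WeakTopology.

(** * Continuous linear functionals on [R * H] *)

Section Pairing.
Context {R : realType} {H : completeNormedModType R} (dot : {dot H for idfun}).
Hypothesis dot_norm : forall v : H, `|v| = Num.sqrt (dot v v).
Implicit Types (v w h : H) (u : (R * H)%type) (s t : R).

Lemma dotC (u v : H) : dot u v = dot v u.
Proof. by rewrite (hermC dot) expr0 mul1r. Qed.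

Lemma dotDl (u v h : H) : dot (u + v) h = dot u h + dot v h.
Proof. exact: linearDl. Qed.

Lemma dotZl t v h : dot (t *: v) h = t * dot v h.
Proof. exact: linearZl_LR. Qed.

Lemma dotDr (h u v : H) : dot h (u + v) = dot h u + dot h v.
Proof. by rewrite !(dotC h) dotDl. Qed.

Lemma dotZr h t v : dot h (t *: v) = t * dot h v.
Proof. by rewrite !(dotC h) dotZl. Qed.

Lemma dot_ge0 v : 0 <= dot v v.
Proof.
have [->|v0] := eqVneq v 0; first by rewrite linear0l.
by rewrite ltW// neq0_dnorm_gt0.
Qed.

Lemma sqr_norm_dot v : `|v| ^+ 2 = dot v v.
Proof. by rewrite dot_norm sqr_sqrtr// dot_ge0. Qed.

(** Cauchy-Schwarz, from the square of [<v, v> u - <u, v> v]. *)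
Lemma dot_le_norm (u v : H) : `|dot u v| <= `|u| * `|v|.
Proof.
have [->|v0] := eqVneq v 0; first by rewrite (dotC u) linear0l normr0 mulr_ge0.
have n0 : 0 < `|v| by rewrite normr_gt0.
rewrite -ler_sqr ?nnegrE ?mulr_ge0//= exprMn real_normK ?num_real//.
have := dot_ge0 (dot v v *: u + (- dot u v) *: v).
rewrite !(dotDl, dotDr, dotZl, dotZr) (dotC v u) !sqr_norm_dot.
have : 0 < dot v v by rewrite -sqr_norm_dot exprn_gt0.
nra.
Qed.

Definition pairing s h u : R^o := s * u.1 + dot u.2 h.

Lemma pairing_is_linear s h : linear (pairing s h).
Proof.
move=> a x y; rewrite /pairing /= dotDl dotZl.
rewrite /GRing.scale /=; ring.
Qed.

HB.instance Definition _ s h :=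
  GRing.isLinear.Build R (R * H)%type R^o *:%R (pairing s h) (pairing_is_linear s h).

Lemma pairing_le_norm s h u : `|pairing s h u| <= (`|s| + `|h|) * `|u|.
Proof.
have [u1 u2] : `|u.1| <= `|u| /\ `|u.2| <= `|u|.
  by rewrite prod_normE !le_max !lexx orbT.
rewrite /pairing (le_trans (ler_normD _ _))// normrM mulrDl lerD ?ler_wpM2l//.
by rewrite (le_trans (dot_le_norm _ _))// mulrC ler_wpM2l.
Qed.

Lemma pairing_continuous s h : continuous (pairing s h).
Proof.
apply/(@linear_bounded_continuous _ _ _ (pairing s h : {linear _ -> R^o}))/linear_boundedP.
exists (`|s| + `|h|); split; first exact: num_real.
by move=> r hr u /=; apply: le_trans (pairing_le_norm s h u) _; rewrite ler_wpM2r// ltW.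
Qed.

Definition dual_pairing s h : dual_space (R * H)%type :=
  exist _ (pairing s h : {linear (R * H)%type -> R^o}) (@pairing_continuous s h).

Lemma dual_pairingE s h u : dual_eval u (dual_pairing s h) = pairing s h u.
Proof. by []. Qed.

Lemma dual_pairing_separates u u' :
  u <> u' -> exists l, dual_eval u l <> dual_eval u' l.
Proof.
move=> uv; apply: contrapT => /forallNP same; apply: uv.
have {}same l : dual_eval u l = dual_eval u' l by apply: contrapT; exact: same.
have := same (dual_pairing 1 0); have := same (dual_pairing 0 (u.2 - u'.2)).
rewrite !dual_pairingE /pairing !mul1r !mul0r !add0r !(dotC _ 0) !linear0l !addr0 => e2 e1.
have /eqP : `|u.2 - u'.2| ^+ 2 = 0.
  by rewrite sqr_norm_dot dotDl e2 -dotDl subrr linear0l.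
rewrite expf_eq0/= normr_eq0 subr_eq0 => /eqP.
by case: u u' e1 {same e2} => [? ?] [? ?] /= -> ->.
Qed.
End Pairing.

(** * Boundedness and approximation *)

Section Bounded.
Context {R : realType} {H : completeNormedModType R} (dot : {dot H for idfun}).
Hypothesis dot_norm : forall v : H, `|v| = Num.sqrt (dot v v).

Lemma weakly_compact_pairing_bounded (K : set (R * H)%type) s h :
  weakly_compact K -> exists M, forall u, K u -> `|pairing dot s h u| <= M.
Proof.
move=> cK; have [->|/set0P K0] := eqVneq K set0; first by exists 0.
have [[a [_ amin]] _] := weakly_compact_argmin (dual_pairing dot_norm s h) cK K0.
have [[b [_ bmin]] _] := weakly_compact_argmin (dual_pairing dot_norm (- s) (- h)) cK K0.
exists (`|pairing dot s h a| + `|pairing dot s h b|) => u Ku.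
have := amin _ Ku; have := bmin _ Ku.
rewrite !dual_pairingE /pairing !linearNr !mulNr.
move=> le_b le_a; rewrite ler_norml; apply/andP; split.
  have := ler_norm (- (s * a.1 + dot a.2 h)); rewrite normrN.
  have := normr_ge0 (s * b.1 + dot b.2 h); lra.
have := ler_norm (s * b.1 + dot b.2 h); have := normr_ge0 (s * a.1 + dot a.2 h); lra.
Qed.

(** Every continuous functional is bounded on [K] because it attains its
    extrema, so the functionals [<u.2, .>], for [u] in [K], are pointwise bounded
    on the complete space [H] and therefore uniformly bounded. *)
Lemma weakly_compact_bounded (K : set (R * H)%type) :
  weakly_compact K -> exists2 M, 0 < M & forall u, K u -> `|u| <= M.
Proof.
move=> cK.
have [M1 bound1] := weakly_compact_pairing_bounded 1 0 cK.
pose F : set (H -> R^o) := [set (dot u.2 : H -> R^o) | u in K].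
have [|x|M2 bound2] := @Banach_Steinhauss R H R^o F _ _ 1.
- move=> _ [u _ <-]; split=> [r|a v w]; last by rewrite dotDr dotZr.
  exists (`|u.2| * r) => v vr.
  by rewrite (le_trans (dot_le_norm dot_norm _ _))// ler_wpM2l.
- have [M HM] := weakly_compact_pairing_bounded 0 x cK.
  by exists M => _ [u Ku <-]; have := HM _ Ku; rewrite /pairing mul0r add0r.
exists (Num.max (Num.max M1 M2) 1) => [|u Ku]; first by rewrite lt_max ltr01 orbT.
rewrite prod_normE ge_max; apply/andP; split.
  have := bound1 _ Ku; rewrite /pairing mul1r linear0r addr0 => h1.
  by rewrite !le_max h1.
have [->|u0] := eqVneq u.2 0; first by rewrite normr0 le_max ler01 orbT.
have n0 : 0 < `|u.2| by rewrite normr_gt0.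
have := bound2 (dot u.2) (ex_intro2 _ _ u Ku erefl) (`|u.2|^-1 *: u.2).
rewrite dotZr -(sqr_norm_dot dot_norm) expr2 mulKf ?gt_eqF// normr_id => bnd.
by rewrite !le_max bnd ?orbT// normrZ normfV normr_id mulVf ?gt_eqF.
Qed.
End Bounded.

Section Hausdorff.
Context {R : realType} {H V : normedModType R}.

Lemma bounded_of_excess_lt1 (S T : set V) M :
  (forall u, S u -> `|u| <= M) ->
  (forall t, T t -> exists2 s, S s & `|t - s| < 1) ->
  forall u, T u -> `|u| <= M + 1.
Proof.
move=> SM TS u /TS[s /SM sM us].
by rewrite -[u](subrK s) addrC (le_trans (ler_normD _ _))// lerD// ltW.
Qed.

Lemma hausdorff_continuous_near (F : H -> set V) x e :
  hausdorff_continuous_at F x -> 0 < e -> \forall y \near x,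
  (forall s, F y s -> exists2 t, F x t & `|s - t| < e) /\
  (forall t, F x t -> exists2 s, F y s & `|t - s| < e).
Proof.
move=> cF e0.
have near0 : nbhs (0 : \bar R)%E [set r | (r < e%:E)%E].
  by have := @open_ereal_lt' R 0%E e%:E; rewrite lte_fin; exact.
have near1 : \forall y \near x, (hausdorff_dist (F y) (F x) < e%:E)%E := cF _ near0.
apply: filterS near1 => y.
rewrite /hausdorff_dist gt_max => /andP[lt1 lt2].
have excess (S T : set V) :
    (ereal_sup [set ereal_inf [set `|s - t|%:E | t in T] | s in S] < e%:E)%E ->
    forall s, S s -> exists2 t, T t & `|s - t| < e.
  move=> ltST s Ss.
  have /ereal_inf_lt[_ [t Tt <-]] : (ereal_inf [set `|s - t|%:E | t in T] < e%:E)%E.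
    by apply: le_lt_trans ltST; apply: ereal_sup_ubound; exists s.
  by rewrite lte_fin => ?; exists t.
by split; exact: excess.
Qed.
End Hausdorff.

Lemma limn_einf_gt0_near {R : realType} (u : nat -> \bar R) :
  (0 < limn_einf u)%E ->
  exists2 c : R, 0 < c & \forall n \near \oo, (c%:E <= u n)%E.
Proof.
rewrite limn_einf_lim (cvg_lim _ (@cvg_einfs_sup R u))// => /ereal_sup_gt[_ [n _ <-] inf_gt0].
have [c c0 c_le] : exists2 c : R, 0 < c & (c%:E <= einfs u n)%E.
  case: (einfs u n) inf_gt0 => [r|_|//]; last by exists 1; rewrite ?leey.
  by rewrite lte_fin => ?; exists r.
exists c => //; near=> m; apply: le_trans c_le _; apply: ereal_inf_lbound.
by exists m => //=; near: m; exists n.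
Unshelve. all: by end_near. Qed.

(** * The regularized model *)

Lemma sup_image_le {R : realType} {T : Type} (S : set T) (g : T -> R) c :
  S !=set0 -> (forall u, S u -> g u <= c) -> sup [set g u | u in S] <= c.
Proof.
by move=> [u Su] gc; apply: ge_sup; [exists (g u), u | move=> _ [v Sv <-]; exact: gc].
Qed.

Lemma le_sup_image {R : realType} {T : Type} (S : set T) (g : T -> R) c u :
  (forall v, S v -> g v <= c) -> S u -> g u <= sup [set g v | v in S].
Proof.
by move=> gc Su; apply: ub_le_sup; [exists c => _ [v Sv <-]; exact: gc | exists u].
Qed.

Lemma le_inf_image {R : realType} {T : Type} (S : set T) (g : T -> R) c :
  S !=set0 -> (forall u, S u -> c <= g u) -> c <= inf [set g u | u in S].
Proof.
by move=> [u Su] gc; apply: lb_le_inf; [exists (g u), u | move=> _ [v Sv <-]; exact: gc].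
Qed.

Lemma inf_image_le {R : realType} {T : Type} (S : set T) (g : T -> R) c u :
  (forall v, S v -> c <= g v) -> S u -> inf [set g v | v in S] <= g u.
Proof.
by move=> gc Su; apply: ge_inf; [exists c => _ [v Sv <-]; exact: gc | exists u].
Qed.

Lemma convex_setP {R : realType} {V : lmodType R} (A : set V) :
  convex_set A <-> forall x y (t : R), A x -> A y -> 0 <= t <= 1 ->
                     A (t *: x + (1 - t) *: y).
Proof.
split=> [cA x y t Ax Ay /andP[t0 t1]|cA x y t].
  by have := cA x y (Itv01 t0 t1); rewrite !inE; apply.
by rewrite !inE => Ax Ay; apply: cA => //; apply/andP; split.
Qed.

Section RegularizedModel.
Context {R : realType} {H : completeNormedModType R} (dot : {dot H for idfun}).
Hypothesis dot_norm : forall v : H, `|v| = Num.sqrt (dot v v).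
Implicit Types (h : H) (z y : (R * H)%type).

Lemma pairing_hull_le (L : set (R * H)%type) s h (c : R) :
  (forall y, L y -> pairing dot s h y <= c) ->
  forall y, closure (convex_hull L) y -> pairing dot s h y <= c.
Proof.
move=> Lc.
pose D := pairing dot s h @^-1` [set r | r <= c].
have cD : closed (D : set (R * H)%type).
  apply: (closed_comp (f := pairing dot s h)); last exact: closed_le.
  by move=> y _; exact: pairing_continuous.
have hullD : convex_hull L `<=` D.
  apply: smallest_sub => //; apply/convex_setP => x y t; rewrite /D /= => xc yc.
  by rewrite linearD !linearZ /= /GRing.scale /= => /andP[t0 t1]; nra.
by move=> y /(closure_subset hullD); rewrite -(proj1 (closure_id _) cD).
Qed.

Variable ldt : \bar R -> H -> set (R * H)%type.

(** The next two lemmas reduce the supremum over the closed convex hull in the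
    definition of [phi] to the points of the truncated set itself. *)
Lemma phi_le h z x nu c : ldt nu x !=set0 ->
  (forall y, ldt nu x y -> pairing dot 1 h (y + z) <= c) ->
  phi dot ldt h z x nu <= c + 2^-1 * `|h| ^+ 2.
Proof.
move=> [y0 Ly0] Lc; rewrite /phi lerD2r; apply: sup_image_le.
  exists (y0 + z), y0 => //; apply: subset_closure.
  exact: sub_gen_smallest.
have Lc' y : ldt nu x y -> pairing dot 1 h y <= c - pairing dot 1 h z.
  by move=> Ly; rewrite lerBrDr -(linearD (pairing dot 1 h)); exact: Lc.
move=> _ [y hy <-]; have := pairing_hull_le Lc' hy.
by rewrite lerBrDr -(linearD (pairing dot 1 h)) /= /pairing mul1r.
Qed.

Lemma phi_ge h z x nu c y :
  (forall y', ldt nu x y' -> pairing dot 1 h y' <= c) -> ldt nu x y ->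
  pairing dot 1 h (y + z) + 2^-1 * `|h| ^+ 2 <= phi dot ldt h z x nu.
Proof.
move=> Lc Ly; rewrite /phi lerD2r [leLHS]/pairing mul1r.
apply: (@le_sup_image _ _ _ _ (c + pairing dot 1 h z) (y + z)).
  move=> _ [y' hy' <-]; have := lerD (pairing_hull_le Lc hy') (lexx (pairing dot 1 h z)).
  by rewrite -(linearD (pairing dot 1 h)) /= /pairing mul1r.
by exists y => //; apply: subset_closure; exact: sub_gen_smallest.
Qed.
End RegularizedModel.

(** * Normalized codifferentials and stationarity *)

Section NormalizedSets.
Context {R : realType} {H : completeNormedModType R} (dot : {dot H for idfun}).
Hypothesis dot_norm : forall v : H, `|v| = Num.sqrt (dot v v).
Implicit Types (S T A : set (R * H)%type) (h v w x : H) (u z : (R * H)%type).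

Lemma pairing1E h u : pairing dot 1 h u = u.1 + dot u.2 h.
Proof. by rewrite /pairing mul1r. Qed.

Lemma pairing_extreme_min T s h : weakly_compact T -> T !=set0 ->
  exists2 e, extreme_points T e &
    forall u, T u -> pairing dot s h e <= pairing dot s h u.
Proof.
exact: (weakly_compact_extreme_argmin (dual_pairing dot_norm s h)
  (dual_pairing_separates dot_norm)).
Qed.

Lemma pairingN s h u : pairing dot (- s) (- h) u = - pairing dot s h u.
Proof. by rewrite /pairing linearNr mulNr opprD. Qed.

Lemma pairing_extreme_max S s h : weakly_compact S -> S !=set0 ->
  exists2 e, extreme_points S e &
    forall u, S u -> pairing dot s h u <= pairing dot s h e.
Proof.
move=> cS S0; have [e extS emin] := pairing_extreme_min (- s) (- h) cS S0.
by exists e => // u Su; have := emin _ Su; rewrite !pairingN lerN2.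
Qed.

Lemma pairing10 u : pairing dot 1 0 u = u.1.
Proof. by rewrite pairing1E linear0r addr0. Qed.

(** Normalization makes the level [0] attained, moreover at an extreme point;
    that point belongs to every truncation. *)
Lemma sup_fst_eq0 S : weakly_compact S -> S !=set0 -> sup [set u.1 | u in S] = 0 ->
  (forall u, S u -> u.1 <= 0) /\ exists2 e, extreme_points S e & e.1 = 0.
Proof.
move=> cS S0 sup0; have [e eS emax] := pairing_extreme_max 1 0 cS S0.
have {}emax u : S u -> u.1 <= e.1 by move=> /emax; rewrite !pairing10.
have Se : S e by case: eS.
have le0 u : S u -> u.1 <= 0.
  by move=> Su; rewrite -sup0; exact: (@le_sup_image _ _ S fst _ u emax Su).
split=> //; exists e => //; apply/eqP; rewrite eq_le le0//=.
by rewrite -sup0; apply: (@sup_image_le _ _ S fst) => //; exists e.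
Qed.

Lemma inf_fst_eq0 T : weakly_compact T -> T !=set0 -> inf [set u.1 | u in T] = 0 ->
  (forall u, T u -> 0 <= u.1) /\ exists2 e, T e & e.1 = 0.
Proof.
move=> cT T0 inf0; have [e [Te _] emin] := pairing_extreme_min 1 0 cT T0.
have {}emin u : T u -> e.1 <= u.1 by move=> /emin; rewrite !pairing10.
have ge0 u : T u -> 0 <= u.1.
  by move=> Tu; rewrite -inf0; exact: (@inf_image_le _ _ T fst _ u emin Tu).
split=> //; exists e => //; apply/eqP; rewrite eq_le ge0// andbT.
by rewrite -inf0; apply: (@le_inf_image _ _ T fst) => //; exists e.
Qed.

(** The level [0] is the face of [S] where the first coordinate is maximal. *)
Lemma zero_face_compact S : weakly_compact S -> (forall u, S u -> u.1 <= 0) ->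
  (exists2 e, extreme_points S e & e.1 = 0) ->
  weakly_compact (S `&` [set u | u.1 = 0]) /\
  extreme_points (S `&` [set u | u.1 = 0]) `<=` extreme_points S.
Proof.
move=> cS le0 [e [Se _] e0].
have -> : S `&` [set u | u.1 = 0] =
    argmin S (fun u => dual_eval u (dual_pairing dot_norm (- 1) (- 0))).
  rewrite eqEsubset; split=> u /= [Su u0]; split=> //.
    by move=> v /le0; rewrite !dual_pairingE !pairingN !pairing10 u0 lerN2.
  have := u0 _ Se; rewrite !dual_pairingE !pairingN !pairing10 e0 lerN2 => ge0.
  by apply/eqP; rewrite eq_le le0.
split; last exact: extreme_points_argmin.
by apply: (weakly_compact_argmin _ cS _).2; exists e.
Qed.

(** The maximum of [<., h>] over the face at level [0] is attained at an extreme
    point [e] of [S] with [e.1 = 0], which no truncation removes. Hence the model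
    at [h] is at least [|h|^2 / 2], while it vanishes at [0]. *)
Lemma stationary_of_halfspace_condition (A : set H) (ud : H -> set (R * H)%type)
    (ldt : \bar R -> H -> set (R * H)%type) S x :
  weakly_compact S -> S !=set0 -> sup [set u.1 | u in S] = 0 ->
  ldt 0%E x `<=` S ->
  [set u | extreme_points S u /\ u.1 = 0] `<=` ldt 0%E x ->
  A x ->
  (forall h w, translate A x h -> ud x (0, w) -> exists2 v, S (0, v) & 0 <= dot (v + w) h) ->
  inf_stationary dot A ud ldt x.
Proof.
move=> cS S0 sup0 ldtS extldt Ax half; split=> //; exists 0 => // w [Tw _].
have [le0 [e0 e0S e00]] := sup_fst_eq0 cS S0 sup0.
have [cF extF] := zero_face_compact cS le0 (ex_intro2 _ _ e0 e0S e00).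
have phi_lower h : translate A x h -> 2^-1 * `|h| ^+ 2 <= phi dot ldt h (0, w) x 0%E.
  move=> Ah; have [v Sv vw] := half _ _ Ah Tw.
  have [|e eF emax] := pairing_extreme_max 0 h cF.
    by exists (0, v).
  have [[Se e1] _] := eF.
  have [M HM] := weakly_compact_pairing_bounded dot_norm 1 h cS.
  have Lb y' : ldt 0%E x y' -> pairing dot 1 h y' <= M.
    by move=> /ldtS Sy; apply: (le_trans _ (HM _ Sy)); exact: ler_norm.
  have Le : ldt 0%E x e by apply: extldt; split=> //; exact: extF.
  apply: (le_trans _ (phi_ge dot_norm (0, w) Lb Le)); rewrite lerDr.
  have := emax _ (conj Sv erefl : (S `&` [set u | u.1 = 0]) (0, v)).
  rewrite pairing1E /pairing !mul0r !add0r /= e1 addr0 add0r.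
  by rewrite dotDl => h1; apply: le_trans vw _; rewrite dotDl lerD2r.
have phi0 : phi dot ldt 0 (0, w) x 0%E <= 0.
  have := @phi_le _ _ dot dot_norm ldt 0 (0, w) x 0%E 0.
  rewrite normr0 expr0n mulr0 addr0; apply; first by exists e0; exact: extldt.
  by move=> y /ldtS Sy; rewrite pairing10 /= addr0 le0.
have A0 : translate A x 0 by exists x => //; rewrite subrr.
rewrite eqEsubset; split=> h.
  move=> [Ah hmin]; have := phi_lower _ Ah.
  have /le_trans/(_ phi0) le_h := hmin _ A0 => /le_trans/(_ le_h) h2.
  have : `|h| ^+ 2 <= 0 by move: h2; rewrite pmulr_rle0// invr_gt0.
  by rewrite exprn_even_le0//= normr_eq0 => /eqP.
move=> ->; split=> // s As; apply: le_trans phi0 _.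
by apply: (le_trans _ (phi_lower _ As)); rewrite mulr_ge0// ?invr_ge0// exprn_ge0.
Qed.
End NormalizedSets.

(** * Decrease of the model near a point violating the half-space condition *)

Section ModelEstimates.
Context {R : realType} {H : completeNormedModType R} (dot : {dot H for idfun}).
Hypothesis dot_norm : forall v : H, `|v| = Num.sqrt (dot v v).
Implicit Types (S T : set (R * H)%type) (h v w x : H) (u z : (R * H)%type).

Lemma fst_le_norm u : `|u.1| <= `|u|.
Proof. by rewrite prod_normE le_max lexx. Qed.

Lemma snd_le_norm u : `|u.2| <= `|u|.
Proof. by rewrite prod_normE le_max lexx orbT. Qed.

Lemma dot_le_mul (v w : H) a b : `|v| <= a -> `|w| <= b -> dot v w <= a * b.
Proof.
move=> va wb; apply: le_trans (ler_norm _) _.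
by apply: le_trans (dot_le_norm dot_norm _ _) _; rewrite ler_pM.
Qed.

(** Along the short multiple [t h] the points of [S] contribute at most [- t c]
    by [perturbed_lower_bound], which beats the quadratic term
    [t^2 |h|^2 / 2]. *)
Lemma model_decrease (A : set H) S x h w :
  convex_set A -> A x -> translate A x h ->
  weakly_compact S -> (forall u, S u -> u.1 <= 0) ->
  (exists2 e, extreme_points S e & e.1 = 0) ->
  (forall v, S (0, v) -> dot (v + w) h < 0) ->
  exists h1 m, [/\ translate A x h1, 0 < m & forall u, S u ->
    u.1 + dot (u.2 + w) h1 + 2^-1 * `|h1| ^+ 2 <= - m].
Proof.
move=> cA Ax [y Ay yh] cS le0 e0 neg.
have [cF _] := zero_face_compact dot_norm cS le0 e0.
have F0 : S `&` [set u | u.1 = 0] !=set0.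
  by have [e [Se _] e1] := e0; exists e.
have [[a1 a] [[Sa /= a10] _] amax] := pairing_extreme_max dot_norm 0 h cF F0.
(* Half of the gap on the face at level [0], so that a strict margin remains. *)
rewrite {a1}a10 in Sa amax; pose c := - dot (a + w) h / 2.
have c0 : 0 < c by have := neg _ Sa; rewrite /c; lra.
have [||t0 t00 Ht] := @perturbed_lower_bound _ _ S (dual_pairing dot_norm (- 1) (- 0))
   (dual_pairing dot_norm (- 0) (- h)) (dot w h + c) cS.
- move=> u Su; rewrite dual_pairingE pairingN pairing10.
  by rewrite oppr_ge0 le0.
- move=> u Su; rewrite !dual_pairingE !pairingN pairing10.
  move=> /eqP; rewrite oppr_eq0 => /eqP u10.
  have := amax u (conj Su u10); rewrite /pairing !mul0r !add0r /= => le_ua.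
  by move: c0; rewrite /c dotDl; lra.
pose D := `|h| ^+ 2 + 1.
have D0 : 0 < D by rewrite ltr_pwDr// exprn_ge0.
pose t := Num.min (Num.min t0 1) (c / D).
have tpos : 0 < t by rewrite !lt_min t00 ltr01 divr_gt0.
have [tt0 t1] : t <= t0 /\ t <= 1 by rewrite !ge_min !lexx !orbT.
have tD : t * D <= c by rewrite -ler_pdivlMr// ge_min lexx orbT.
exists (t *: h), (t * c / 2); split.
- exists (t *: y + (1 - t) *: x).
    by move/convex_setP: cA; apply=> //; rewrite t1 ltW.
  by rewrite -yh scalerBr scalerBl scale1r -addrA [x - _ - _]addrAC subrr add0r.
- by rewrite divr_gt0// mulr_gt0.
move=> u Su; have := Ht t u; rewrite tpos tt0 => /(_ isT Su).
rewrite !dual_pairingE !pairingN pairing10 /pairing mul0r add0r.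
rewrite dotZr dotDl normrZ gtr0_norm// exprMn.
have : t * (t * `|h| ^+ 2) <= t * c.
  rewrite ler_wpM2l// ?(ltW tpos)//; apply: (le_trans _ tD).
  by rewrite ler_wpM2l// ?(ltW tpos)// lerDl.
rewrite expr2; set N := `|h| ^+ 2; lra.
Qed.

(** The point [z] is an extreme point that minimizes [u.1 + t <u.2, h>] over
    [T]. Comparing it with a point of [T] near [(0, w)] bounds [<z.2, h>] after
    division by [t], because [z.1 >= 0], and bounds [z.1] by [O(t)], because [T]
    is bounded. So [t] is chosen first, and only then the required proximity
    [eta]. *)
Lemma extreme_near_slice h w M d : 0 < d -> 0 <= M -> `|w| <= M ->
  exists2 eta, 0 < eta & forall T, weakly_compact T ->
    (forall u, T u -> 0 <= u.1) -> (forall u, T u -> `|u| <= M) ->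
    (exists2 u, T u & `|(0, w) - u| < eta) ->
    exists2 z, extreme_points T z & z.1 <= d /\ dot z.2 h <= dot w h + d.
Proof.
move=> d0 M0 wM.
have D0 : 0 < 4 * (M * `|h|) + 2 * d + 1.
  have : 0 <= M * `|h| by rewrite mulr_ge0.
  lra.
pose t := d / (4 * (M * `|h|) + 2 * d + 1).
have t0 : 0 < t by rewrite divr_gt0.
have tD : t * (4 * (M * `|h|) + 2 * d + 1) = d by rewrite divfK// gt_eqF.
have h1 : 0 < 1 + `|h| by rewrite ltr_pwDl.
exists (t * d / (1 + `|h|)); first by rewrite divr_gt0// mulr_gt0.
set eta := t * d / (1 + `|h|) => T cT ge0 TM [u Tu uw].
have etaE : eta * (1 + `|h|) = t * d by rewrite divfK// gt_eqF.
have T0 : T !=set0 by exists u.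
have [z zT zmin] := pairing_extreme_min dot_norm 1 (t *: h) cT T0.
have Tz : T z by case: zT.
exists z => //.
have := zmin _ Tu; rewrite !pairing1E !dotZr => le_zu.
have u1 : u.1 <= eta.
  have := le_trans (fst_le_norm ((0, w) - u)) (ltW uw); rewrite /= sub0r normrN.
  exact: le_trans (ler_norm _).
have u2 : dot u.2 h <= dot w h + eta * `|h|.
  have := dot_le_mul (v := u.2 - w) (w := h) (a := eta) (b := `|h|).
  rewrite distrC (le_trans (snd_le_norm ((0, w) - u)) (ltW uw)) => /(_ isT (lexx _)).
  by rewrite linearBl lerBlDl.
have z1 := ge0 _ Tz.
have wz : dot w h - dot z.2 h <= 2 * (M * `|h|).
  have h3 : dot w h <= M * `|h| by exact: dot_le_mul.
  have := dot_le_mul (v := - z.2) (w := h) (a := M) (b := `|h|).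
  rewrite normrN (le_trans (snd_le_norm z) (TM _ Tz)) => /(_ isT (lexx _)).
  by rewrite linearNl; lra.
have eta0 : 0 <= eta by apply: divr_ge0; [apply: mulr_ge0|]; exact: ltW.
have Mh : 0 <= M * `|h| by rewrite mulr_ge0.
have t1 : t <= 1 by rewrite ler_pdivrMr// mul1r; lra.
have teh : t * (eta * `|h|) <= eta * `|h| by rewrite ler_piMl// mulr_ge0.
have tu : t * dot u.2 h <= t * (dot w h) + t * (eta * `|h|).
  by rewrite -mulrDr ler_pM2l.
have twz : t * (dot w h - dot z.2 h) <= t * (2 * (M * `|h|)) by rewrite ler_pM2l.
split; first by nra.
by rewrite -(ler_pM2l t0); nra.
Qed.

(** Half of the decrease of the model persists under perturbations of the
    direction and of the hypodifferential. The point [z] enters only through its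
    norm, [z.1] and [<z.2, h1>], so it need not be close to [(0, w)]. *)
Lemma model_decrease_stable S h1 w m M : 0 < m -> 0 <= M ->
  (forall u, S u -> u.1 + dot (u.2 + w) h1 + 2^-1 * `|h1| ^+ 2 <= - m) ->
  exists2 eta, 0 < eta & forall h (y s z : (R * H)%type),
    `|h - h1| <= eta -> S s -> `|y - s| <= eta -> `|y| <= M -> `|z| <= M ->
    z.1 <= eta -> dot z.2 h1 <= dot w h1 + eta ->
    pairing dot 1 h (y + z) + 2^-1 * `|h| ^+ 2 <= - (m / 2).
Proof.
move=> m0 M0 Sm.
(* [eta * D] bounds the sum of all the perturbation errors when [eta <= 1]. *)
pose D := 4 + 2 * M + 2 * `|h1|.
have D1 : 1 <= D by rewrite /D; have := normr_ge0 h1; lra.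
have D0 : 0 < D by lra.
pose eta := Num.min 1 (m / 2 / D).
have eta0 : 0 < eta by rewrite lt_min ltr01 divr_gt0// divr_gt0.
have eta1 : eta <= 1 by rewrite ge_min lexx.
have etaD : eta * D <= m / 2 by rewrite -ler_pdivlMr// ge_min lexx orbT.
exists eta => // h y s z hh1 Ss ys yM zM z1 z2.
rewrite pairing1E /= dotDl.
have y1 : y.1 <= s.1 + eta.
  by rewrite -lerBlDl (le_trans (ler_norm _))// (le_trans (fst_le_norm (y - s))).
have yh : dot y.2 (h - h1) <= M * eta.
  by apply: dot_le_mul => //; exact: le_trans (snd_le_norm y) yM.
have zh : dot z.2 (h - h1) <= M * eta.
  by apply: dot_le_mul => //; exact: le_trans (snd_le_norm z) zM.
have ysh : dot (y.2 - s.2) h1 <= eta * `|h1|.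
  by apply: dot_le_mul => //; exact: le_trans (snd_le_norm (y - s)) ys.
have nh : `|h| <= `|h1| + eta.
  have -> : h = h1 + (h - h1) by rewrite addrC subrK.
  by rewrite (le_trans (ler_normD _ _))// lerD2l.
have nh2 : `|h| ^+ 2 <= (`|h1| + eta) ^+ 2 by rewrite ler_sqr ?nnegrE// (le_trans _ nh).
move: yh zh ysh; rewrite !linearBr linearBl => yh zh ysh.
have := Sm _ Ss; rewrite dotDl.
have ee : eta * eta <= eta by rewrite ler_piMl// ltW.
move: nh2; rewrite sqrrD -mulr_natr [eta ^+ 2]expr2; set a := `|h| ^+ 2; set b := `|h1| ^+ 2.
have := etaD; rewrite /D; move: (`|h1|) ysh => n ysh etaD' nh2 low.
have etaD2 : 4 * eta + 2 * (M * eta) + 2 * (eta * n) <= m / 2.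
  by apply: le_trans etaD'; rewrite le_eqVlt; apply/orP; left; apply/eqP; ring.
have {}nh2 : a <= b + 2 * (eta * n) + eta * eta.
  by apply: le_trans nh2 _; rewrite le_eqVlt; apply/orP; left; apply/eqP; ring.
lra.
Qed.

(** The model is defined with the truncated set, the linearization with the whole
    of [S]. They agree for short steps: the functional [u.1 + alpha <u.2, hn>] is
    maximized over [S] at an extreme point [e'] with [e'.1 >= - 8 alpha M^2], and
    such a point is not truncated. As [e'.1 <= 0] and [alpha <= 1], its value is
    at most [alpha] times its contribution to the model. *)
Lemma linearized_decrease S T (ldt : \bar R -> H -> set (R * H)%type) x nu z hn m M c :
  weakly_compact S -> (forall u, S u -> u.1 <= 0) ->
  (exists2 e, extreme_points S e & e.1 = 0) -> (forall u, S u -> `|u| <= M) ->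
  weakly_compact T -> T z -> `|z| <= M -> 0 <= z.1 ->
  ldt nu x `<=` S ->
  [set u | extreme_points S u /\ (- nu <= u.1%:E)%E] `<=` ldt nu x ->
  0 <= m -> phi dot ldt hn z x nu <= - m ->
  0 < c -> (c%:E <= nu)%E ->
  `|hn| <= 4 * M /\ forall alpha, 0 < alpha <= 1 -> 8 * alpha * M ^+ 2 <= c ->
    sup [set pairing dot 1 (alpha *: hn) u | u in S] +
    inf [set pairing dot 1 (alpha *: hn) u | u in T] <= - (alpha * m) + z.1.
Proof.
move=> cS le0 [e eS e1] SM cT Tz zM z1 ldtS extldt m0 phi_m c0 cnu.
have Se : S e by case: eS.
have S0 : S !=set0 by exists e.
have [B HB] := weakly_compact_pairing_bounded dot_norm 1 hn cS.
have {phi_m}low y : ldt nu x y ->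
    y.1 + z.1 + dot (y.2 + z.2) hn + 2^-1 * `|hn| ^+ 2 <= - m.
  move=> Ly; apply: (le_trans _ phi_m); rewrite -(pairing1E dot hn (y + z)).
  apply: (@phi_ge _ _ _ dot_norm _ _ _ _ _ B) Ly => y' /ldtS Sy'.
  by apply: (le_trans _ (HB _ Sy')); exact: ler_norm.
have ext_ldt u : extreme_points S u -> - c <= u.1 -> ldt nu x u.
  move=> uS cu; apply: extldt; split=> //.
  by rewrite leeNl -EFinN; apply: le_trans cnu; rewrite lee_fin lerNl.
have M0 : 0 <= M by exact: le_trans (normr_ge0 _) zM.
have e2hn : - (M * `|hn|) <= dot e.2 hn.
  rewrite lerNl -linearNl; apply: dot_le_mul => //.
  by rewrite normrN (le_trans (snd_le_norm e))// SM.
have z2hn : - (M * `|hn|) <= dot z.2 hn.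
  rewrite lerNl -linearNl; apply: dot_le_mul => //.
  by rewrite normrN (le_trans (snd_le_norm z)).
(* The untruncated point [e] at level [0] makes the model at least
   [- 2 M |hn| + |hn|^2 / 2], which is nonpositive only if [|hn| <= 4 M]. *)
have nhn : `|hn| <= 4 * M.
  have : ldt nu x e by apply: ext_ldt => //; rewrite e1 oppr_le0 ltW.
  move/low; rewrite e1 dotDl => low_e.
  rewrite leNgt; apply/negP => lt_hn.
  move: low_e e2hn z2hn lt_hn; rewrite expr2; have := normr_ge0 hn; nra.
split=> // alpha /andP[a0 a1] ac.
have [e' e'S e'max] := pairing_extreme_max dot_norm 1 (alpha *: hn) cS S0.
have Se' : S e' by case: e'S.
have := e'max _ Se; rewrite !pairing1E !dotZr e1 add0r => le_ee'.
have e'2hn : dot e'.2 hn <= M * `|hn|.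
  by apply: dot_le_mul => //; rewrite (le_trans (snd_le_norm e'))// SM.
have Le' : ldt nu x e'.
  apply: ext_ldt => //.
  have : alpha * (dot e'.2 hn - dot e.2 hn) <= alpha * (2 * (M * (4 * M))).
    rewrite ler_pM2l//.
    have : M * `|hn| <= M * (4 * M) by rewrite ler_wpM2l.
    lra.
  move: ac; rewrite expr2; nra.
have := low _ Le'; have := le0 _ Se' => e'1; rewrite dotDl => low_e'.
have supS : sup [set pairing dot 1 (alpha *: hn) u | u in S] <= e'.1 + alpha * dot e'.2 hn.
  by apply: sup_image_le => // u /e'max; rewrite [in leRHS]pairing1E dotZr.
have infT : inf [set pairing dot 1 (alpha *: hn) u | u in T] <= z.1 + alpha * dot z.2 hn.
  have [B' HB'] := weakly_compact_pairing_bounded dot_norm 1 (alpha *: hn) cT.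
  rewrite -dotZr -pairing1E; apply: (@inf_image_le _ _ _ _ (- B')) => // u Tu.
  by have := HB' _ Tu; rewrite ler_norml => /andP[].
have : 0 <= `|hn| ^+ 2 by rewrite exprn_ge0.
nra.
Qed.
End ModelEstimates.

(** * Uniform decrease of the objective function *)

Section Descent.
Context {R : realType} {H : completeNormedModType R} (dot : {dot H for idfun}).
Hypothesis dot_norm : forall v : H, `|v| = Num.sqrt (dot v v).

Lemma codiff_errorE (f : H -> R) S T alpha dx x : 0 < alpha ->
  f (x + alpha *: dx) =
    f x + (sup [set pairing dot 1 (alpha *: dx) u | u in S] +
           inf [set pairing dot 1 (alpha *: dx) u | u in T])
    + alpha * codiff_error dot f S T alpha dx x.
Proof.
move=> a0.
have pairE : pairing dot 1 (alpha *: dx) = (fun u : R * H => u.1 + alpha * dot u.2 dx).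
  by apply/funext => u; rewrite pairing1E dotZr.
rewrite pairE /codiff_error mulVKf ?gt_eqF//; ring.
Qed.

Variables (U A : set H) (f : H -> R) (ld ud : H -> set (R * H)%type).
Variables (ldt udt : \bar R -> H -> set (R * H)%type) (astar : \bar R) (xstar : H).
Hypothesis A_convex : convex_set A.
Hypothesis A_sub_U : A `<=` U.
Hypothesis f_codiff : forall x, U x -> is_codifferential dot f x (ld x) (ud x).
Hypothesis f_normalized : forall x, U x -> normalized (ld x) (ud x).
Hypothesis f_truncated : truncated_codifferential U ld ud ldt udt.
Hypothesis astar_gt0 : (0 < astar)%E.
Hypothesis Axstar : A xstar.
Hypothesis ld_continuous : hausdorff_continuous_at ld xstar.
Hypothesis ud_continuous : hausdorff_continuous_at ud xstar.
Hypothesis f_approx : exists C : set H,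
  [/\ nbhs xstar C, C `<=` U & uniformly_approximates dot U f ld ud C].

Lemma hypodifferential_props x : U x ->
  [/\ weakly_compact (ld x), ld x !=set0, forall u, ld x u -> u.1 <= 0
    & exists2 e, extreme_points (ld x) e & e.1 = 0].
Proof.
move=> Ux; have [[S0 _] _ [cS _] _ _] := f_codiff Ux; have [sup0 _] := f_normalized Ux.
by have [le0 e0] := sup_fst_eq0 dot_norm cS S0 sup0.
Qed.

Lemma hyperdifferential_props x : U x ->
  weakly_compact (ud x) /\ forall u, ud x u -> 0 <= u.1.
Proof.
move=> Ux; have [[_ T0] _ [_ cT] _ _] := f_codiff Ux; have [_ inf0] := f_normalized Ux.
by have [ge0 _] := inf_fst_eq0 dot_norm cT T0 inf0.
Qed.

(** The order of choices matters. The step length [alpha] depends only on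
    [c], [astar], the codifferential at [x*] and the modulus of uniform
    approximation; after that [d], the admissible size of [z.1], is made small
    compared with [alpha m]; the neighbourhood of [x*] comes last. *)
Lemma descent_step c h w : 0 < c ->
  translate A xstar h -> ud xstar (0, w) ->
  (forall v, ld xstar (0, v) -> dot (v + w) h < 0) ->
  exists2 beta, 0 < beta & \forall x \near xstar, A x ->
    forall nu mu, (c%:E <= nu)%E -> (c%:E <= mu)%E ->
    exists2 z, udt mu x z & forall hn,
      argmin (translate A x) (fun h => phi dot ldt h z x nu) hn ->
      exists a, [/\ 0 <= a, (a%:E <= astar)%E, A (x + a *: hn)
                  & f (x + a *: hn) <= f x - beta].
Proof.
move=> c0 Ah Tw neg.
have [cS _ Sle0 Se0] := hypodifferential_props (A_sub_U Axstar).
have [cT _] := hyperdifferential_props (A_sub_U Axstar).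
have [h1 [m0 [[y1 Ay1 y1h] m00 Sm0]]] :=
  model_decrease dot_norm A_convex Axstar Ah cS Sle0 Se0 neg.
have [MS MS0 HMS] := weakly_compact_bounded dot_norm cS.
have [MT MT0 HMT] := weakly_compact_bounded dot_norm cT.
pose M := MS + MT + 1.
have M0 : 0 < M by rewrite /M; lra.
pose m := m0 / 2.
have mpos : 0 < m by rewrite divr_gt0.
have [eta1 eta10 Heta1] := model_decrease_stable dot_norm m00 (ltW M0) Sm0.
have [C [Cnbhs CU [r r0 [_ approx]]]] := f_approx.
(* [|hn| <= 4 M] may exceed the radius [r] of uniform approximation, so the step
   [alpha hn] is written as [alpha' (hn / s)] with [alpha' = alpha s]. *)
pose s := 4 * M / r.
have s0 : 0 < s by rewrite divr_gt0// mulr_gt0.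
have [b b0 b_astar] : exists2 b : R, 0 < b & (b%:E <= astar)%E.
  case: astar astar_gt0 => [b|_|//]; last by exists 1; rewrite ?leey.
  by rewrite lte_fin => ?; exists b.
pose B := Num.min (Num.min 1 b) (c / (8 * M ^+ 2)).
have M2 : 0 < 8 * M ^+ 2 by rewrite mulr_gt0// exprn_gt0.
have B0 : 0 < B by rewrite !lt_min ltr01 b0 divr_gt0.
have e0 : 0 < m / (4 * s) by rewrite divr_gt0// mulr_gt0.
have [alpha' [[a'0 a'B] Halpha']] : exists alpha', (0 < alpha' /\ alpha' <= B * s) /\
    forall dx x, closed_ball (0 : H) r dx -> C x ->
      `|codiff_error dot f (ld x) (ud x) alpha' dx x| < m / (4 * s).
  near (0 : R)^'+ => alpha'; exists alpha'; split; last by near: alpha'; exact: approx.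
  split; near: alpha'; first exact: nbhs_right_gt.
  by apply: nbhs_right_le; rewrite mulr_gt0.
pose alpha := alpha' / s.
have a0 : 0 < alpha by rewrite divr_gt0.
have aB : alpha <= B by rewrite ler_pdivrMr.
have a1 : alpha <= 1 by rewrite (le_trans aB)// !ge_min lexx.
have ab : alpha <= b by rewrite (le_trans aB)// !ge_min lexx !orbT.
have ac : 8 * alpha * M ^+ 2 <= c.
  have : alpha <= c / (8 * M ^+ 2) by rewrite (le_trans aB)// !ge_min lexx !orbT.
  by rewrite ler_pdivlMr// mulrCA mulrA.
pose d := Num.min (Num.min (alpha * m / 4) eta1) c.
have d0 : 0 < d by rewrite !lt_min eta10 c0 divr_gt0// mulr_gt0.
have wM : `|w| <= M.
  by rewrite (le_trans (snd_le_norm (0, w)))// (le_trans (HMT _ Tw))// /M; lra.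
have [eta2 eta20 Heta2] := extreme_near_slice dot_norm h1 d0 (ltW M0) wM.
exists (alpha * m / 2); first by rewrite divr_gt0// mulr_gt0.
have min10 (e : R) : 0 < e -> 0 < Num.min e 1 by rewrite lt_min ltr01 andbT.
have := hausdorff_continuous_near ld_continuous (min10 _ eta10).
have := hausdorff_continuous_near ud_continuous (min10 _ eta20).
move=> near_ud near_ld; near=> x => Ax nu mu cnu cmu.
have Ux := A_sub_U Ax.
have [cSx _ Sxle0 [ex exS ex1]] := hypodifferential_props Ux.
have [cTx Txge0] := hyperdifferential_props Ux.
have [ld_x _] :
  (forall s, ld x s -> exists2 t, ld xstar t & `|s - t| < Num.min eta1 1) /\
  (forall t, ld xstar t -> exists2 s, ld x s & `|t - s| < Num.min eta1 1) by near: x.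
have [ud_x ud_x'] :
  (forall s, ud x s -> exists2 t, ud xstar t & `|s - t| < Num.min eta2 1) /\
  (forall t, ud xstar t -> exists2 s, ud x s & `|t - s| < Num.min eta2 1) by near: x.
have Cx : C x by near: x.
have xx : `|xstar - x| <= eta1 by near: x; exact: cvgr_dist_le.
have ldM u : ld x u -> `|u| <= M.
  move=> Lu; have near1 v : ld x v -> exists2 t, ld xstar t & `|v - t| < 1.
    by move=> /ld_x[t ? lt_t]; exists t => //; move: lt_t; rewrite lt_min => /andP[].
  by have := bounded_of_excess_lt1 HMS near1 Lu; rewrite /M; lra.
have udM u : ud x u -> `|u| <= M.
  move=> Lu; have near1 v : ud x v -> exists2 t, ud xstar t & `|v - t| < 1.
    by move=> /ud_x[t ? lt_t]; exists t => //; move: lt_t; rewrite lt_min => /andP[].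
  by have := bounded_of_excess_lt1 HMT near1 Lu; rewrite /M; lra.
have [|z zT [zd zh1]] := Heta2 _ cTx Txge0 udM.
  by have [u Tu] := ud_x' _ Tw; rewrite lt_min => /andP[? _]; exists u.
have Tz : ud x z by case: zT.
move: zd; rewrite !le_min => /andP[/andP[z_am z_eta] z_c].
have dle : d <= eta1 by rewrite !ge_min lexx !orbT.
have nu0 : (0 <= nu)%E by apply: le_trans cnu; rewrite lee_fin ltW.
have mu0 : (0 <= mu)%E by apply: le_trans cmu; rewrite lee_fin ltW.
have [ldt_sup ldt_sub] := f_truncated.1 _ _ nu0 Ux.
have [udt_sup _] := f_truncated.2 _ _ mu0 Ux.
exists z => [|hn [[yn Ayn ynh] hn_min]].
  by apply: udt_sup; split=> //; apply: le_trans cmu; rewrite lee_fin.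
have hn_phi : phi dot ldt hn z x nu <= - m.
  apply: (le_trans (hn_min (y1 - x) _)); first by exists y1.
  have -> : - m = - m - 2^-1 * `|y1 - x| ^+ 2 + 2^-1 * `|y1 - x| ^+ 2 by rewrite subrK.
  apply: phi_le => //.
    by exists ex; apply: ldt_sup; split=> //; rewrite ex1 oppe_le0.
  move=> y /ldt_sub Sy; rewrite lerBrDr.
  have [t St] := ld_x _ Sy; rewrite lt_min => /andP[yt _].
  apply: (Heta1 _ y t z) => //; [|exact: ltW|exact: ldM|exact: udM|].
    by rewrite -y1h opprB addrC addrA subrK.
  by rewrite (le_trans zh1)// lerD2l.
have [hnM] := linearized_decrease dot_norm cSx Sxle0 (ex_intro2 _ _ ex exS ex1) ldM
  cTx Tz (udM _ Tz) (Txge0 _ Tz) ldt_sub ldt_sup (ltW mpos) hn_phi c0 cnu.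
move=> /(_ alpha); rewrite a0 a1 => /(_ isT ac) lin.
exists alpha; split; first exact: ltW.
- by apply: le_trans b_astar; rewrite lee_fin.
- rewrite -ynh scalerBr addrCA -{1}[x]scale1r -scalerBl.
  by move/convex_setP: A_convex; apply=> //; rewrite a1 ltW.
have ahE : alpha *: hn = alpha' *: (s^-1 *: hn) by rewrite scalerA.
have err : alpha' * codiff_error dot f (ld x) (ud x) alpha' (s^-1 *: hn) x <= alpha * m / 4.
  have : `|codiff_error dot f (ld x) (ud x) alpha' (s^-1 *: hn) x| < m / (4 * s).
    apply: Halpha' => //; rewrite closed_ballE// /closed_ball_ /= sub0r normrN.
    rewrite normrZ gtr0_norm ?invr_gt0// mulrC ler_pdivrMr// /s mulrC divfK ?gt_eqF//.
  move=> /ltW /(le_trans (ler_norm _)) le_e.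
  apply: le_trans (ler_wpM2l (ltW a'0) le_e) _.
  rewrite le_eqVlt; apply/orP; left; apply/eqP; rewrite /alpha; field.
  by rewrite gt_eqF.
rewrite ahE (codiff_errorE _ (ld x) (ud x))// -ahE.
lra.
Unshelve. all: by end_near. Qed.
End Descent.

(** * Convexity and the limit argument *)

(** Choose [w] to minimize [<., h>] on the face of [T] at level [0], and [v] by the
    half-space condition. Then [f (x + t h) >= f x - o(t)] for [h = y - x], by
    [perturbed_lower_bound] for the infimum over [T], and convexity of [f] turns
    this into [f y >= f x]. *)
Lemma convex_stationary_min {R : realType} {H : completeNormedModType R}
    (dot : {dot H for idfun}) (dot_norm : forall v : H, `|v| = Num.sqrt (dot v v))
    (U A : set H) (f : H -> R) (S T : set (R * H)%type) (x : H) :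
  A `<=` U -> A x -> is_codifferential dot f x S T -> normalized S T ->
  convex_function U f ->
  (forall h w, translate A x h -> T (0, w) ->
     exists2 v, S (0, v) & 0 <= dot (v + w) h) ->
  forall y, A y -> f x <= f y.
Proof.
move=> AU Ax [[S0 T0] _ [cS cT] f_lim _] [sup0 inf0] f_convex half y Ay.
have [Sle0 _] := sup_fst_eq0 dot_norm cS S0 sup0.
have [Tge0 [e1 Te1 e10]] := inf_fst_eq0 dot_norm cT T0 inf0.
have [F0 cF] := weakly_compact_argmin (dual_pairing dot_norm 1 0) cT T0.
set F := argmin _ _ in F0 cF.
have FE u : F u <-> T u /\ u.1 = 0.
  split=> [[Tu umin]|[Tu u0]]; split=> //.
    have := umin _ Te1; rewrite !dual_pairingE !pairing10 e10 => u_le0.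
    by apply/eqP; rewrite eq_le u_le0 Tge0.
  by move=> v Tv; rewrite !dual_pairingE !pairing10 u0 Tge0.
pose h := y - x.
have Ah : translate A x h by exists y.
have [[b w] [Fw _] wmin] := pairing_extreme_min dot_norm 0 h cF F0.
have [Tw /= b0] := (FE _).1 Fw; rewrite {b}b0 in Fw wmin Tw.
have [v Sv vw] := half _ _ Ah Tw.
apply/ler_addgt0Pr => e e0.
have e2 : 0 < e / 2 by rewrite divr_gt0.
have [||t0 t00 Ht] := @perturbed_lower_bound _ _ T (dual_pairing dot_norm 1 0)
   (dual_pairing dot_norm 0 h) (dot w h - e / 2) cT.
- by move=> u Tu; rewrite dual_pairingE pairing10 Tge0.
- move=> u Tu; rewrite !dual_pairingE pairing10 => u10.
  have := wmin u ((FE _).2 (conj Tu u10)); rewrite /pairing !mul0r !add0r /=; lra.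
have [t [[tpos tt0 t1] err]] : exists t, [/\ 0 < t, t <= t0 & t <= 1] /\
    `|codiff_error dot f S T t h x| < e / 2.
  near (0 : R)^'+ => t; exists t; split.
    by split; near: t; [exact: nbhs_right_gt|exact: nbhs_right_le|exact: nbhs_right_le].
  near: t; have /cvgrPdist_lt/(_ _ e2) := f_lim h.
  by apply: filterS => t; rewrite sub0r normrN normr_id.
have sup_ge : t * dot v h <= sup [set pairing dot 1 (t *: h) u | u in S].
  have [B HB] := weakly_compact_pairing_bounded dot_norm 1 (t *: h) cS.
  have -> : t * dot v h = pairing dot 1 (t *: h) (0, v) by rewrite pairing1E add0r dotZr.
  apply: (@le_sup_image _ _ _ _ B) => // u Su.
  by apply: (le_trans _ (HB _ Su)); exact: ler_norm.
have inf_ge : t * (dot w h - e / 2) <= inf [set pairing dot 1 (t *: h) u | u in T].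
  apply: le_inf_image => // u Tu; have := Ht t u; rewrite tpos tt0 => /(_ isT Tu).
  by rewrite !dual_pairingE pairing10 pairing1E /pairing mul0r add0r dotZr.
have := @f_convex (Itv01 (ltW tpos) t1) y x.
rewrite !inE => /(_ (AU _ Ay) (AU _ Ax)).
have -> : conv (Itv01 (ltW tpos) t1) (y : convex_lmodType H) x = x + t *: h.
  have -> : conv (Itv01 (ltW tpos) t1) (y : convex_lmodType H) x = t *: y + (1 - t) *: x by [].
  by rewrite /h scalerBr scalerBl scale1r addrCA.
rewrite (codiff_errorE dot f S T h x tpos).
move=> cvx.
have {}cvx : f x + (sup [set pairing dot 1 (t *: h) u | u in S] +
    inf [set pairing dot 1 (t *: h) u | u in T]) + t * codiff_error dot f S T t h x <=
    t * f y + (1 - t) * f x by exact: cvx.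
have err' : - (e / 2) <= codiff_error dot f S T t h x.
  by move/ltW: err; rewrite ler_norml => /andP[].
have terr : t * - (e / 2) <= t * codiff_error dot f S T t h x by rewrite ler_pM2l.
have tvw : 0 <= t * (dot v h + dot w h) by rewrite -dotDl mulr_ge0// ltW.
rewrite -(ler_pM2l tpos); lra.
Unshelve. all: by end_near. Qed.

Lemma frequent_decrease_unbounded {R : realType} (u : nat -> R) (beta : R) :
  (forall n, u n.+1 <= u n) -> 0 < beta ->
  (forall N, exists2 n, (N <= n)%N & u n.+1 <= u n - beta) ->
  ~ has_lbound (range u).
Proof.
move=> u_decr beta0 freq [L uL].
have below k : exists n, u n <= u 0%N - k%:R * beta.
  elim: k => [|k [n un]]; first by exists 0%N; rewrite mul0r subr0.
  have [n' nn' un'] := freq n; exists n'.+1; apply: (le_trans un').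
  have /nonincreasing_seqP mono := u_decr.
  by have := mono _ _ nn'; rewrite -natr1; lra.
have [n] := below (Num.truncn ((u 0%N - L) / beta)).+1.
have : (u 0%N - L) / beta < (Num.truncn ((u 0%N - L) / beta)).+1%:R.
  exact: truncnS_gt.
rewrite ltr_pdivrMr//; have := uL (u n) (ex_intro2 _ _ n I erefl).
lra.
Qed.


Theorem theorem5 (R : realType) (H : completeNormedModType R)
    (dot : {dot H for idfun})
    (dot_norm : forall v : H, `|v| = Num.sqrt (dot v v))
    (U A : set H) (f : H -> R)
    (ld ud : H -> set (R * H)%type)
    (ldt udt : \bar R -> H -> set (R * H)%type)
    (U_open : open U) (A_closed : closed A) (A_convex : convex_set A)
    (A_sub_U : A `<=` U)
    (f_codiff : forall x, U x -> is_codifferential dot f x (ld x) (ud x))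
    (f_normalized : forall x, U x -> normalized (ld x) (ud x))
    (f_truncated : truncated_codifferential U ld ud ldt udt)
    (nu mu : nat -> \bar R) (astar : \bar R) (xs : nat -> H) (xstar : H)
    (nu_ge0 : forall n, (0 <= nu n)%E) (mu_ge0 : forall n, (0 <= mu n)%E)
    (astar_gt0 : (0 < astar)%E)
    (xs_generated : qr_mcd dot f A ldt udt nu mu astar xs)
    (xstar_cluster : cluster (xs @ \oo) xstar)
    (ld_continuous : hausdorff_continuous_at ld xstar)
    (ud_continuous : hausdorff_continuous_at ud xstar)
    (f_approx : exists C : set H,
       [/\ nbhs xstar C, C `<=` U & uniformly_approximates dot U f ld ud C])
    (f_bounded : has_lbound (f @` A))
    (nu_liminf : (0 < limn_einf nu)%E) (mu_liminf : (0 < limn_einf mu)%E)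
    (cases : finite_dimensional H \/
       exists2 muhat : R, 0 < muhat &
         \forall n \near \oo,
           [set u | ud (xs n) u /\ u.1 <= muhat] `<=` udt (mu n) (xs n)) :
  inf_stationary dot A ud ldt xstar /\
  (convex_set U /\ convex_function U f ->
   A xstar /\ forall y, A y -> f xstar <= f y).
Proof.
have xsA n : A (xs n).
  have [A0 [hn [al [zn gen]]]] := xs_generated.
  elim: n => // n _; have [_ al_min [zn_udt _] ->] := gen n.
  by have [[]] := al_min _ zn_udt.
have Axstar : A xstar.
  rewrite ((closure_id A).1 A_closed) => B Bx.
  by apply: (xstar_cluster A B) Bx; exists 0%N => // n _; exact: xsA.
have Uxstar := A_sub_U _ Axstar.
have [cS S0 Sle0 Se0] := hypodifferential_props dot_norm f_codiff f_normalized Uxstar.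
have half h w : translate A xstar h -> ud xstar (0, w) ->
    exists2 v, ld xstar (0, v) & 0 <= dot (v + w) h.
  move=> Ah Tw; apply: contrapT => nhalf.
  have neg v : ld xstar (0, v) -> dot (v + w) h < 0.
    by move=> Sv; rewrite ltNge; apply/negP => ?; apply: nhalf; exists v.
  have [c1 c10 near_nu] := limn_einf_gt0_near nu_liminf.
  have [c2 c20 near_mu] := limn_einf_gt0_near mu_liminf.
  have c0 : 0 < Num.min c1 c2 by rewrite lt_min c10.
  have [beta beta0 step] := descent_step dot_norm A_convex A_sub_U f_codiff
    f_normalized f_truncated astar_gt0 Axstar ld_continuous ud_continuous
    f_approx c0 Ah Tw neg.
  have [_ [hn [al [zn gen]]]] := xs_generated.
  apply: (@frequent_decrease_unbounded _ (f \o xs) beta) => //.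
  - move=> n /=; have [_ al_min [zn_udt _] ->] := gen n.
    have [_ /(_ 0)] := al_min _ zn_udt; rewrite scale0r addr0; apply.
    by split=> //; [exact: ltW | rewrite scale0r addr0].
  - move=> N.
    (* Cluster points see only the tail of the sequence, where the truncation
       levels are at least [c1] and [c2]. *)
    pose tail := [set n | [/\ (N <= n)%N, (c1%:E <= nu n)%E & (c2%:E <= mu n)%E]].
    have tail_near : (xs @ \oo) (xs @` tail).
      have : \forall n \near \oo, tail n.
        by near=> n; split; near: n; [exact: nbhs_infty_ge|exact: near_nu|exact: near_mu].
      by apply: filterS => n tail_n; exists n.
    have [_ [[n [Nn nun mun] <-] /(_ (xsA n))]] := xstar_cluster _ _ tail_near step.
    move=> /(_ (nu n) (mu n)).
    case.
    + by apply: le_trans nun; rewrite lee_fin ge_min lexx.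
    + by apply: le_trans mun; rewrite lee_fin ge_min lexx orbT.
    move=> z z_udt dec; exists n => //=.
    have [hn_min al_min [_ zn_min] ->] := gen n.
    have [|a [a0 a_astar Aa fa]] := dec (hn n z); first by rewrite (hn_min _ z_udt).
    apply: (le_trans (zn_min _ z_udt)); apply: (le_trans _ fa).
    by apply: (al_min _ z_udt).2.
  - have [L fL] := f_bounded; exists L => _ [n _ <-]; apply: fL.
    by exists (xs n).
split.
  have [ldt_sup ldt_sub] := f_truncated.1 _ _ (lexx 0%E) Uxstar.
  have [sup0 _] := f_normalized _ Uxstar.
  apply: (@stationary_of_halfspace_condition _ _ dot dot_norm A ud ldt (ld xstar)) => //.
  by move=> u [uS u0]; apply: ldt_sup; split=> //; rewrite u0 oppe0.
move=> [_ f_convex]; split=> // y Ay.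
exact: (convex_stationary_min dot_norm A_sub_U Axstar
  (f_codiff _ Uxstar) (f_normalized _ Uxstar) f_convex half).
Unshelve. all: by end_near. Qed.
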